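(* Let $[a,b]$ be a compact subinterval of $\mathbb{R}$ and let $f:[a,b]\to\mathbb{R}$ be a function. Let $A$ be the directed set of all pairs $(P,\delta)$, where $\delta$ is a gauge on $[a,b]$ and $P$ is a $\delta$-fine tagged partition of $[a,b]$. For $\gamma=(P,\delta)\in A$ put $I(\gamma)=S(P,f)$ and $J(\gamma)=S(P,|f|)$. Then $f$ is Lebesgue integrable on $[a,b]$ if and only if both generalized sequences $\{I(\gamma)\}_{\gamma\in A}$ and $\{J(\gamma)\}_{\gamma\in A}$ are convergent.
   Context: A gauge on $[a,b]$ is a function $\delta:[a,b]\to\mathbb{R}$ with $\delta(x)>0$ for all $x$. A tagged partition of $[a,b]$ is $P=\{x_0,\dots,x_n;c_1,\dots,c_n\}$ with $a=x_0<x_1<\dots<x_n=b$ and $c_i\in[x_{i-1},x_i]$ for each $i$. For a function $h:[a,b]\to\mathbb{R}$, the Riemann sum is $S(P,h)=\sum_{i=1}^n h(c_i)(x_i-x_{i-1})$. The tagged partition $P$ is $\delta$-fine if $[x_{i-1},x_i]\subset(c_i-\delta(c_i),c_i+\delta(c_i))$ for each $i=1,\dots,n$. A directed set is a non-empty set with a reflexive, transitive relation (''$e$ follows $c$'') such that any two elements $c,d$ have a common element $e$ following both. A generalized sequence (net) is a function defined on a directed set. The set $A$ is directed by: $(P,\delta)$ follows $(P_1,\delta_1)$ if $\delta(x)\le\delta_1(x)$ for all $x\in[a,b]$ (no condition relating $P$ and $P_1$). A real-valued generalized sequence $\{I(\gamma)\}_{\gamma\in A}$ is convergent if there is a real number $L$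 such that for each $\epsilon>0$ there is $\gamma_0\in A$ with $|I(\gamma)-L|<\epsilon$ for every $\gamma\in A$ that follows $\gamma_0$. Lebesgue integrable on $[a,b]$ has the usual meaning: $f$ is Lebesgue measurable and the Lebesgue integral of $|f|$ over $[a,b]$ is finite. *)

(* Defs.v *)
From mathcomp Require Import all_boot all_order all_algebra.
From mathcomp Require Import all_classical all_reals all_analysis.

Set Implicit Arguments.
Unset Strict Implicit.
Unset Printing Implicit Defensive.

Import Order.TTheory GRing.Theory Num.Theory.
Import numFieldNormedType.Exports.

Local Open Scope classical_set_scope.
Local Open Scope ring_scope.

(* [follows e c] reads "e follows c". *)
Record directed_set := DirectedSet {
  dir_carrier :> Type;
  follows : dir_carrier -> dir_carrier -> Prop;
  dir_nonempty : inhabited dir_carrier;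
  follows_refl : forall c, follows c c;
  follows_trans : forall c d e, follows e d -> follows d c -> follows e c;
  follows_common : forall c d, exists e, follows e c /\ follows e d }.

Definition net_convergent (R : realType) (A : directed_set) (I : A -> R) : Prop :=
  exists L : R, forall eps : R, 0 < eps ->
    exists g0 : A, forall g : A, follows g g0 -> `|I g - L| < eps.

(* [pt_seq] lists x_1, ..., x_n, the point x_0 = a being left implicit as in
   [itv_partition], and [tag_seq] lists c_1, ..., c_n. The cells are indexed
   from 0: the i-th one is [part_pt P i, part_pt P i.+1], with tag
   [part_tag P i], for i < n. The empty partition (n = 0) exists only when
   a = b. *)
Record tagged_partition (R : realType) (a b : R) := TaggedPartition {
  pt_seq : seq R;
  tag_seq : seq R;
  pt_seq_partition : itv_partition a b pt_seq;
  size_tag_seq : size tag_seq = size pt_seq;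
  tag_in_cell : forall i, (i < size pt_seq)%N ->
    nth b (a :: pt_seq) i <= nth a tag_seq i <= nth b (a :: pt_seq) i.+1 }.

Section tagged_partition.
Context {R : realType} {a b : R}.
Implicit Types (P : tagged_partition a b) (h delta : R -> R).

Definition part_size P : nat := size (pt_seq P).
Definition part_pt P (i : nat) : R := nth b (a :: pt_seq P) i.
Definition part_tag P (i : nat) : R := nth a (tag_seq P) i.

Definition riemann_sum P h : R :=
  \sum_(i < part_size P) h (part_tag P i) * (part_pt P i.+1 - part_pt P i).

Definition delta_fine delta P : Prop :=
  forall i, (i < part_size P)%N ->
    `[part_pt P i, part_pt P i.+1] `<=`
    `](part_tag P i - delta (part_tag P i)),
      (part_tag P i + delta (part_tag P i))[.

End tagged_partition.

(* Functions on [a, b] are total functions on R whose values outside [a, b]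
   are never used. *)
Definition is_gauge (R : realType) (a b : R) (delta : R -> R) : Prop :=
  forall x, x \in `[a, b] -> 0 < delta x.

Lemma cousin (R : realType) (a b : R) (delta : R -> R) :
  a <= b -> is_gauge a b delta ->
  exists P : tagged_partition a b, delta_fine delta P.
Proof.
move=> ab gd.
pose T := [set x | a <= x <= b /\
  exists P : tagged_partition x b, delta_fine delta P].
have Tcons x y c : a <= x -> x < y -> x <= c <= y -> c - delta c < x ->
    y < c + delta c -> T y -> T x.
  move=> ax xy cxy cx yc [/andP[ay yb] [[s t [ps ls] st ts] fP]].
  split; first by rewrite ax (le_trans (ltW xy)).
  have ps' : itv_partition x b (y :: s) by split => //=; rewrite xy.
  have st' : size (c :: t) = size (y :: s) by rewrite /= st.
  have ts' i : (i < size (y :: s))%N -> nth b (x :: y :: s) i <=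
      nth x (c :: t) i <= nth b (x :: y :: s) i.+1.
    case: i => [_ //|i] /= si.
    by have := ts i si; rewrite (@set_nth_default _ t x y) ?st.
  exists (TaggedPartition ps' st' ts') => -[|i] /= si z /=.
    rewrite !in_itv/= /part_pt /part_tag/= => /andP[xz zy].
    by rewrite (lt_le_trans cx)// (le_lt_trans zy).
  have := fP i si z; rewrite /part_pt /part_tag/=.
  by rewrite (@set_nth_default _ t x y) ?st.
have Tb : T b.
  split; first by rewrite ab lexx.
  have ps : itv_partition b b ([::] : seq R) by split.
  by exists (@TaggedPartition _ b b [::] [::] ps erefl
    (fun i (si : (i < 0)%N) => ltac:(by []))) => i.
have hT : has_inf T by split; [exists b|exists a => x [/andP[]]].
pose m := inf T.
have am : a <= m by apply: lb_le_inf; [exists b|move=> x [/andP[]]].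
have mb : m <= b by apply: ge_inf => //; case: hT.
have dm : 0 < delta m by apply: gd; rewrite in_itv/= am.
have Tm : T m.
  have [x Tx xm] := inf_adherent dm hT.
  have : m <= x by apply: ge_inf => //; case: hT.
  rewrite le_eqVlt => /predU1P[->//|mx].
  apply: (Tcons m x m) => //; first by rewrite lexx ltW.
  by rewrite ltrBlDr ltrDl.
move: am; rewrite le_eqVlt => /predU1P[->|am]; first by case: Tm.
pose y := Num.max a (m - delta m / 2).
have ym : y < m by rewrite gt_max am/= ltrBlDr ltrDl divr_gt0.
have : T y.
  apply: (Tcons y m m) => //; first by rewrite le_max lexx.
  - by rewrite lexx ltW.
  - by rewrite lt_max ltrD2l ltrN2 gtr_pMr// invf_lt1// ltr1n orbT.
  - by rewrite ltrDl.
move=> Ty; have : m <= y by apply: ge_inf => //; case: hT.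
by rewrite leNgt ym.
Qed.

Section fine_pairs.
Context {R : realType} {a b : R}.

Record fine_pair := FinePair {
  fp_part : tagged_partition a b;
  fp_gauge : R -> R;
  fp_gaugeP : is_gauge a b fp_gauge;
  fp_fine : delta_fine fp_gauge fp_part }.

Definition fp_follows (g g1 : fine_pair) : Prop :=
  forall x, x \in `[a, b] -> fp_gauge g x <= fp_gauge g1 x.

Context (ab : a <= b).

Lemma fp_nonempty : inhabited fine_pair.
Proof.
have g1 : is_gauge a b (fun=> 1) by move=> x _; exact: ltr01.
by have [P fP] := cousin ab g1; exists; exact: (FinePair g1 fP).
Qed.

Lemma fp_follows_refl g : fp_follows g g. Proof. by []. Qed.

Lemma fp_follows_trans c d e :
  fp_follows e d -> fp_follows d c -> fp_follows e c.
Proof. by move=> ed dc x xab; exact: le_trans (ed x xab) (dc x xab). Qed.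

Lemma fp_follows_common c d : exists e, fp_follows e c /\ fp_follows e d.
Proof.
pose delta x := Num.min (fp_gauge c x) (fp_gauge d x).
have gd : is_gauge a b delta.
  by move=> x xab; rewrite lt_min (fp_gaugeP c xab) (fp_gaugeP d xab).
have [P fP] := cousin ab gd.
exists (FinePair gd fP); split=> x _ /=; first by rewrite ge_min lexx.
by rewrite ge_min lexx orbT.
Qed.

Definition fine_pairs : directed_set :=
  DirectedSet fp_nonempty fp_follows_refl fp_follows_trans fp_follows_common.

End fine_pairs.
Arguments fine_pair {R} a b.

(* [completed_lebesgue_measure] lives on the Lebesgue sigma-algebra, whereas
   [lebesgue_measure] would require f to be Borel measurable. *)
Definition lebesgue_integrable (R : realType) (a b : R) (f : R -> R) : Prop :=
  (@completed_lebesgue_measure R).-integrable `[a, b] (EFin \o f).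

(* Main.v *)
Require Import Defs.
From mathcomp Require Import all_boot all_order all_algebra.
From mathcomp Require Import all_classical all_reals all_analysis.
From mathcomp Require Import measurable_realfun lra.
Import Order.TTheory GRing.Theory Num.Theory.
Import numFieldNormedType.Exports.
Local Open Scope classical_set_scope.
Local Open Scope ring_scope.

(* Convergence of the nets is integrability in the Henstock-Kurzweil sense.

   If [f >= 0] is Lebesgue measurable, cover each level set [{f > k eta}] by an
   open set [O_k] of almost the same measure: [u = eta + eta sum_k 1_(O_k)] has
   almost the same integral as [f], and each [c] has a neighbourhood on which
   [f c <= u], because only finitely many [O_k] matter.  The radii of these
   neighbourhoods form a gauge whose fine Riemann sums are at most the integral
   of [u].  Truncation from below extends this upper bound to every integrable
   [f], and applying it to [- f] gives the lower bound.

   Conversely, if [g >= 0] has gauge integral [I] and [delta] works for [eps],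
   cut [a, b] into [n] equal cells and give each cell the supremum of [g] over
   its points [c] at which [delta c] exceeds the length of the cell.  These step
   functions have integral at most [I + eps], and their lower limit is
   measurable and at least [g], so Fatou's lemma and [eps -> 0] yield a
   measurable [u >= g] of integral at most [I].  By the direct implication
   [u - g >= 0] has a nonpositive gauge integral, and the same majorant
   construction for [u - g] shows that [u = g] almost everywhere.  Finally [f]
   is half the difference of [|f| + f] and [|f| - f]. *)

Set Implicit Arguments.
Unset Strict Implicit.
Unset Printing Implicit Defensive.

(** * Suprema of sets whose sums of choices are bounded *)

Lemma has_sup_of_bounded_sums {R : realType} n (W : 'I_n -> set R) (K : R) :
  (forall i, W i 0) ->
  (forall w, (forall i, W i (w i)) -> \sum_(i < n) w i <= K) ->
  forall i, has_sup (W i).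
Proof.
move=> W0 WK i; split; first by exists 0.
exists K => w Ww.
(* This choice is [w] at [i] and 0 elsewhere, so its sum is [w]. *)
have := WK (fun j => if j == i then w else 0).
rewrite (bigD1 i)//= eqxx big1 => [|j /negbTE->//]; rewrite addr0; apply=> j.
by case: eqP => [->|].
Qed.

(** Pick elements within [e / n.+1%:R] of the suprema: the [n] errors add up to at most [e], and the
    successor keeps the divisor positive when [n = 0]. *)
Lemma sum_sup_le {R : realType} n (W : 'I_n -> set R) (K : R) :
  (forall i, W i 0) ->
  (forall w, (forall i, W i (w i)) -> \sum_(i < n) w i <= K) ->
  \sum_(i < n) sup (W i) <= K.
Proof.
move=> W0 WK; have supW := has_sup_of_bounded_sums W0 WK.
apply/ler_addgt0Pr => e e0.
have en0 : 0 < e / n.+1%:R by rewrite divr_gt0.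
pose w i := projT1 (cid2 (sup_adherent en0 (supW i))).
have wP i : W i (w i) /\ sup (W i) - e / n.+1%:R < w i.
  by rewrite /w; case: cid2.
have := WK w (fun i => (wP i).1) => wK.
apply: (@le_trans _ _ (\sum_(i < n) (w i + e / n.+1%:R))).
  by apply: ler_sum => i _; rewrite -lerBlDr ltW//; exact: (wP i).2.
rewrite big_split/= sumr_const card_ord lerD//.
rewrite -[leLHS]mulr_natr mulrAC.
by rewrite ler_pdivrMr// ler_wpM2l ?(ltW e0)// ler_nat.
Qed.

(** * Series of scaled indicators, layer sums and truncation *)

Section indic_series.
Context d (T : measurableType d) (R : realType) (m : {measure set T -> \bar R}).
Variables (D : set T) (r : R) (A : (set T)^nat).
Hypotheses (mD : measurable D) (r0 : 0 <= r) (mA : forall k, measurable (A k)).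
Local Open Scope ereal_scope.

Lemma scaled_indic_ge0 (B : set T) x : 0 <= r%:E * (\1_B x)%:E :> \bar R.
Proof. by rewrite -EFinM lee_fin mulr_ge0. Qed.

Lemma indic_series_ge0 x : 0 <= \sum_(k <oo) r%:E * (\1_(A k) x)%:E :> \bar R.
Proof. by apply: nneseries_ge0 => k _ _; exact: scaled_indic_ge0. Qed.

Let measurable_term k :
  measurable_fun D (fun x => r%:E * (\1_(A k) x)%:E : \bar R).
Proof.
by apply: measurable_funeM; apply/measurable_EFinP; exact: measurable_indic.
Qed.

Lemma measurable_indic_series :
  measurable_fun D (fun x => \sum_(k <oo) r%:E * (\1_(A k) x)%:E : \bar R).
Proof.
by apply: ge0_emeasurable_sum => [k x _ _|k _]; [exact: scaled_indic_ge0|].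
Qed.

(** Termwise integration of a nonnegative series; it serves both for the level sets of a function
    and for the open sets covering them. *)
Lemma integral_indic_series :
  \int[m]_(x in D) (\sum_(k <oo) r%:E * (\1_(A k) x)%:E) =
  \sum_(k <oo) r%:E * m (A k `&` D).
Proof.
rewrite integral_nneseries//; last by move=> k x _; exact: scaled_indic_ge0.
apply: eq_eseriesr => k _; rewrite ge0_integralZl_EFin//.
- by rewrite integral_indic.
- by apply/measurable_EFinP; exact: measurable_indic.
Qed.

End indic_series.

Lemma layer_sum_le {R : realType} (r y : R) m : 0 <= r -> 0 <= y ->
  \sum_(k < m) r * (k.+1%:R * r < y)%R%:R <= y.
Proof.
(* The second bound drives the induction: if layer [m] counts, then [m.+1%:R * r < y] and the new
   sum is at most [m.+1%:R * r]; otherwise the sum does not change. *)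
move=> r0 y0; suff : \sum_(k < m) r * (k.+1%:R * r < y)%R%:R <= y /\
    \sum_(k < m) r * (k.+1%:R * r < y)%R%:R <= m%:R * r by case.
elim: m => [|m [ih1 ih2]]; first by rewrite big_ord0 mul0r.
rewrite big_ord_recr/= -natr1 mulrDl mul1r.
by have [|_] := ltP (_ + r) y; rewrite ?mulr1 ?mulr0; lra.
Qed.

(** Dominated convergence with dominating function [|f|]: if every truncation had an integral
    exceeding that of [f] by more than [e], the limit of these integrals would exceed itself by
    [e]. *)
Lemma integral_truncation_le d (T : measurableType d) (R : realType)
    (m : {measure set T -> \bar R}) (D : set T) (f : T -> R) (e : R) :
  measurable D -> m.-integrable D (EFin \o f) -> 0 < e ->
  exists n : nat,
    m.-integrable D (fun x => (Num.max (f x) (- n%:R))%:E) /\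
    (\int[m]_(x in D) (Num.max (f x) (- n%:R))%:E <=
      \int[m]_(x in D) (f x)%:E + e%:E)%E.
Proof.
move=> mD fi e0.
have mf : measurable_fun D f.
  by apply/measurable_EFinP; exact: measurable_int fi.
pose F (n : nat) (x : T) := Num.max (f x) (- n%:R).
have mF n : measurable_fun D (EFin \o F n).
  by apply/measurable_EFinP; exact: measurable_maxr.
have leF n x : `|F n x| <= `|f x|.
  rewrite /F; have [_|/ltW fn] := leP (- n%:R) (f x); first by [].
  have n0 : 0 <= n%:R :> R by [].
  by rewrite normrN ger0_norm// ler0_norm; lra.
have iF n : m.-integrable D (EFin \o F n).
  by apply: le_integrable (fi) => // x _; rewrite /= lee_fin.
have [| |_ _ cF] := dominated_convergence mD mF (measurable_int _ fi) _
  (integrable_norm fi).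
- apply: aeW => x _; apply: cvg_near_cst.
  exists (Num.truncn `|f x|).+1 => // n /= xn; congr EFin; apply/max_idPl.
  rewrite lerNl (le_trans (ler_norm _))// normrN.
  by rewrite (le_trans (ltW (truncnS_gt _)))// ler_nat.
- by apply: aeW => x n _; rewrite /= lee_fin.
apply: contrapT => /forallNP nF.
have fin : (\int[m]_(x in D) (f x)%:E)%E \is a fin_num.
  exact: integrable_fin_num.
suff : (\int[m]_(x in D) (f x)%:E + e%:E <= \int[m]_(x in D) (f x)%:E)%E.
  by rewrite leNgt -[ltLHS]adde0 lteD2lE// lte_fin e0.
rewrite -[leRHS](cvg_lim _ cF)//; apply: lime_ge.
  by apply/cvg_ex; exists (\int[m]_(x in D) (f x)%:E)%E.
apply: nearW => n; rewrite leNgt; apply/negP => /ltW Fn.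
by apply: (nF n); split => //; exact: iF.
Qed.

(** Completeness makes [g] measurable, whatever its values on the null set where it differs from
    [f]. *)
Lemma complete_ae_eq_integrable d (T : measurableType d) (R : realType)
    (m : {measure set T -> \bar R}) (D : set T) (f g : T -> \bar R) :
  measure_is_complete m -> measurable D -> ae_eq m D f g ->
  m.-integrable D f -> m.-integrable D g.
Proof.
move=> cm mD fg /integrableP[mf foo].
have mg := ae_measurable_fun cm fg mf.
apply/integrableP; split => //.
rewrite -(@ge0_ae_eq_integral _ _ _ m D (abse \o f))//.
- exact: measurableT_comp.
- exact: measurableT_comp.
- by move=> x _; exact: abse_ge0.
- exact: ae_eq_abse.
Qed.

(** * Gauge integrals and fine partitions *)

Section gauge_integral.
Context {R : realType}.
Implicit Types (a b x y z c v I : R) (f g h delta : R -> R).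

Definition gauge_integral a b f I := forall eps, 0 < eps ->
  exists2 delta, is_gauge a b delta &
    forall P : tagged_partition a b, delta_fine delta P ->
      `|riemann_sum P f - I| < eps.

Lemma part_tag_itv a b (P : tagged_partition a b) i : (i < part_size P)%N ->
  a <= part_tag P i <= b.
Proof.
move=> si; have /andP[t1 t2] := tag_in_cell si; apply/andP; split.
  apply: le_trans t1; apply: itv_partition_nth_ge (pt_seq_partition P).
  by rewrite ltnS ltnW.
by apply: (le_trans t2); apply: itv_partition_nth_le (pt_seq_partition P).
Qed.

(** Following constrains only the gauges. The gauge of [g0] serves for every partition fine for it;
    conversely Cousin's lemma completes a gauge to a pair, and a pair with a smaller gauge is fine
    for the larger one. *)
Lemma net_convergentP a b (ab : a <= b) f :
  net_convergent (fun g : fine_pairs ab => riemann_sum (fp_part g) f) <->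
  exists I, gauge_integral a b f I.
Proof.
split=> -[I fI]; exists I => e e0; have := fI e e0.
  move=> [g0 g0P]; exists (fp_gauge g0); first exact: fp_gaugeP.
  by move=> P fP; apply: (g0P (FinePair (fp_gaugeP g0) fP)) => x _ /=.
move=> [delta gd dP]; have [P0 fP0] := cousin ab gd.
exists (FinePair gd fP0) => -[P d gd' fP] /= le_d; apply: dP => i si x.
move=> /(fP i si x); rewrite /= !in_itv/=.
have tagab : part_tag P i \in `[a, b] by rewrite in_itv; exact: part_tag_itv.
have := le_d _ tagab; rewrite /= => ?; lra.
Qed.

Lemma riemann_sumD a b (P : tagged_partition a b) f g :
  riemann_sum P (fun x => f x + g x) = riemann_sum P f + riemann_sum P g.
Proof. by rewrite -big_split; apply: eq_bigr => i _; rewrite mulrDl. Qed.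

Lemma riemann_sumN a b (P : tagged_partition a b) f :
  riemann_sum P (fun x => - f x) = - riemann_sum P f.
Proof. by rewrite -sumrN; apply: eq_bigr => i _; rewrite mulNr. Qed.

Lemma is_gauge_min a b delta delta' : is_gauge a b delta ->
  is_gauge a b delta' -> is_gauge a b (fun x => Num.min (delta x) (delta' x)).
Proof. by move=> gd gd' x xab; rewrite lt_min gd// gd'. Qed.

Lemma delta_fineS a b delta delta' (P : tagged_partition a b) :
  (forall x, delta x <= delta' x) -> delta_fine delta P -> delta_fine delta' P.
Proof.
move=> dd' fP i si x /(fP i si x); rewrite /= !in_itv/=.
by have := dd' (part_tag P i) => ?; lra.
Qed.

Lemma gauge_integralD a b f g I J :
  gauge_integral a b f I -> gauge_integral a b g J ->
  gauge_integral a b (fun x => f x + g x) (I + J).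
Proof.
move=> fI gJ e e0; have e20 : 0 < e / 2 by rewrite divr_gt0.
have [d gd dP] := fI _ e20; have [d' gd' dP'] := gJ _ e20.
exists (fun x => Num.min (d x) (d' x)); first exact: is_gauge_min.
move=> P fP; rewrite riemann_sumD opprD addrACA [e]splitr.
rewrite (le_lt_trans (ler_normD _ _))// ltrD//.
- by apply: dP; apply: delta_fineS fP => x; rewrite ge_min lexx.
- by apply: dP'; apply: delta_fineS fP => x; rewrite ge_min lexx orbT.
Qed.

Lemma gauge_integralN a b f I :
  gauge_integral a b f I -> gauge_integral a b (fun x => - f x) (- I).
Proof.
move=> fI e e0; have [d gd dP] := fI _ e0; exists d => // P fP.
by rewrite riemann_sumN -opprD normrN dP.
Qed.

(** The possible Riemann sums of [h] over [delta]-fine partitions of [x, z], given inductively so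
    that concatenation and induction on cells avoid list indices. *)
Inductive fine_sum delta h : R -> R -> R -> Prop :=
| fine_sum_nil x : fine_sum delta h x x 0
| fine_sum_cons x y z c v : x < y -> x <= c <= y ->
    c - delta c < x -> y < c + delta c -> fine_sum delta h y z v ->
    fine_sum delta h x z (h c * (y - x) + v).

Lemma fine_sum1 delta h x y c : x < y -> x <= c <= y ->
  c - delta c < x -> y < c + delta c ->
  fine_sum delta h x y (h c * (y - x)).
Proof.
move=> xy xcy cx yc; rewrite -[_ * _]addr0.
exact/(fine_sum_cons xy xcy cx yc)/fine_sum_nil.
Qed.

Lemma fine_sum_cat delta h x y z v w :
  fine_sum delta h x y v -> fine_sum delta h y z w ->
  fine_sum delta h x z (v + w).
Proof.
elim=> [x' |x' y' z' c v' xy xcy cx yc _ ih] yz; first by rewrite add0r.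
by rewrite -addrA; apply: (fine_sum_cons xy xcy cx yc); exact: ih.
Qed.

Lemma fine_sum_le delta h x z v : fine_sum delta h x z v -> x <= z.
Proof. by elim=> // {}x y {}z c {}v xy _ _ _ _ /(le_trans (ltW xy)). Qed.

Lemma fine_sum_partition delta h a b v : fine_sum delta h a b v ->
  exists2 P : tagged_partition a b, delta_fine delta P & riemann_sum P h = v.
Proof.
elim=> {a b v} [x|x y z c v xy xcy cx yc _ [[s t [ps ls] st ts] fP <-]].
  have ps : itv_partition x x ([::] : seq R) by split.
  exists (@TaggedPartition _ x x [::] [::] ps erefl
    (fun i (si : (i < 0)%N) => ltac:(by []))) => [i//|].
  by rewrite /riemann_sum big_ord0.
have ps' : itv_partition x z (y :: s) by split => //=; rewrite xy.
have st' : size (c :: t) = size (y :: s) by rewrite /= st.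
have ts' i : (i < size (y :: s))%N -> nth z (x :: y :: s) i <=
    nth x (c :: t) i <= nth z (x :: y :: s) i.+1.
  case: i => [_ //|i] /= si.
  (* The default for tags is the left endpoint, which moves from [y] to [x]; below the size of [t]
     the two defaults agree. *)
  by have := ts i si; rewrite (@set_nth_default _ t x y) ?st.
exists (TaggedPartition ps' st' ts') => [[|i] /= si u /=|].
- rewrite !in_itv/= /part_pt /part_tag/= => /andP[xu uy].
  by rewrite (lt_le_trans cx)// (le_lt_trans uy).
- have := fP i si u; rewrite /part_pt /part_tag/=.
  by rewrite (@set_nth_default _ t x y) ?st.
- rewrite /riemann_sum /part_size/= big_ord_recl; congr (_ + _).
  apply: eq_bigr => i _; rewrite /part_pt /part_tag/=.
  by rewrite (@set_nth_default _ t x y) ?st.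
Qed.

Lemma part_pt_lt a b (P : tagged_partition a b) i : (i < part_size P)%N ->
  part_pt P i < part_pt P i.+1.
Proof.
case: P => s t [ps ls] st ts; rewrite /part_size /part_pt/= => si.
by move/(pathP b) : ps => /(_ i si).
Qed.

Lemma part_pt_le a b (P : tagged_partition a b) i j :
  (i <= j <= part_size P)%N -> part_pt P i <= part_pt P j.
Proof.
move=> /andP[ij jP]; rewrite -(subnKC ij) in jP *.
elim: (j - i)%N jP => [|k ih] jP; first by rewrite addn0.
rewrite addnS in jP *; apply: le_trans (ih (ltnW jP)) _.
exact/ltW/part_pt_lt.
Qed.

Lemma part_pt_size a b (P : tagged_partition a b) :
  part_pt P (part_size P) = b.
Proof. exact: itv_partition_nth_size (pt_seq_partition P). Qed.

Lemma partition_fine_sum delta h a b (P : tagged_partition a b) :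
  delta_fine delta P -> fine_sum delta h a b (riemann_sum P h).
Proof.
move=> fP; rewrite /riemann_sum -(big_mkord xpredT (fun i =>
  h (part_tag P i) * (part_pt P i.+1 - part_pt P i))).
suff H k : (k <= part_size P)%N -> fine_sum delta h a (part_pt P k)
    (\sum_(0 <= i < k) h (part_tag P i) * (part_pt P i.+1 - part_pt P i)).
  by rewrite -[b in fine_sum _ _ _ b](part_pt_size P); exact: H.
elim: k => [_|k ih kP]; first by rewrite big_nil; exact: fine_sum_nil.
rewrite big_nat_recr//=; apply: fine_sum_cat (ih (ltnW kP)) _.
have ltk := part_pt_lt kP; have lek := ltW ltk.
apply: fine_sum1 => //; first exact: (tag_in_cell kP).
  have := fP k kP (part_pt P k); rewrite /= !in_itv/= lexx lek.
  by move=> /(_ isT)/andP[].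
have := fP k kP (part_pt P k.+1); rewrite /= !in_itv/= lexx lek.
by move=> /(_ isT)/andP[].
Qed.

Lemma fine_sum_exists delta h a b : a <= b ->
  (forall x, a <= x <= b -> 0 < delta x) ->
  (forall x, a <= x <= b -> 0 <= h x) ->
  exists2 v, 0 <= v & fine_sum delta h a b v.
Proof.
move=> ab gd h0.
have gd' : is_gauge a b delta by move=> x; rewrite in_itv; exact: gd.
have [P fP] := cousin ab gd'.
exists (riemann_sum P h); last exact: partition_fine_sum.
apply: sumr_ge0 => -[i /= si] _; rewrite mulr_ge0//.
  exact/h0/part_tag_itv.
by rewrite subr_ge0 ltW// part_pt_lt.
Qed.

Lemma riemann_sum_cst a b (P : tagged_partition a b) c :
  riemann_sum P (fun=> c) = c * (b - a).
Proof.
rewrite /riemann_sum -mulr_sumr.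
rewrite -(big_mkord xpredT (fun i => part_pt P i.+1 - part_pt P i)).
by rewrite telescope_sumr// part_pt_size.
Qed.

Lemma ler_riemann_sum a b (P : tagged_partition a b) f g :
  (forall x, f x <= g x) -> riemann_sum P f <= riemann_sum P g.
Proof.
move=> fg; apply: ler_sum => -[i /= si] _; rewrite ler_wpM2r//.
by rewrite subr_ge0 ltW// part_pt_lt.
Qed.

End gauge_integral.

(** * Lebesgue integrable functions are gauge integrable *)

Section lebesgue.
Context {R : realType}.
Implicit Types (a b x y z c v e I : R) (f g h delta : R -> R).
Notation mu := (@completed_lebesgue_measure R).
Notation LR := (caratheodory_type (wlength (@idfun R))^*%mu).

Lemma measurable_completed (A : set R) :
  measurable A -> measurable (A : set LR).
Proof. exact: sub_caratheodory. Qed.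

Lemma measurable_completed_itv (i : interval R) :
  measurable ([set` i] : set LR).
Proof. exact: measurable_completed. Qed.

Lemma completed_lebesgue_measure_itv (i : interval R) :
  mu [set` i] = (if i.1 < i.2 then (i.2 : \bar R) - i.1 else 0)%E.
Proof. exact: lebesgue_measure_itv. Qed.

Lemma completed_lebesgue_measure_segment a b : a <= b ->
  (mu : {measure set LR -> \bar R}) `[a, b]%classic = (b - a)%:E.
Proof.
move=> ab; rewrite [LHS]completed_lebesgue_measure_itv/= lte_fin.
by case: ltP => // ba; congr EFin; lra.
Qed.

(** Every point of a fine cell lies within [delta c] of the tag [c], so [u] is at least [f c] on the
    whole cell; the integrals over the cells add up. *)
Lemma fine_sum_le_integral a b delta f (u : LR -> \bar R) :
  measurable_fun (`[a, b] : set LR) u ->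
  (forall x, a <= x <= b -> 0 <= f x) ->
  (forall x, a <= x <= b -> (0 <= u x)%E) ->
  (forall c t, a <= c <= b -> a <= t <= b -> c - delta c < t < c + delta c ->
    ((f c)%:E <= u t)%E) ->
  forall v, fine_sum delta f a b v -> (v%:E <= \int[mu]_(x in `[a, b]) u x)%E.
Proof.
move=> mu_ f0 u0 fu v.
suff H x z : fine_sum delta f x z v -> a <= x -> z <= b ->
    (v%:E <= \int[mu]_(x in `[x, z]) u x)%E by move=> /H; apply.
elim=> {x z v} [x ax xb|x y z c v xy xcy cx yc /fine_sum_le yz ih ax zb].
  by apply: integral_ge0 => t; rewrite /= in_itv/= => ?; apply: u0; lra.
have mxy := measurable_completed_itv `[x, y[.
have myz := measurable_completed_itv `[y, z].
have xyz : `[x, z]%classic = `[x, y[ `|` `[y, z].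
  by rewrite -itv_bndbnd_setU// bnd_simp ltW.
rewrite xyz ge0_integral_setU//; last 3 first.
- apply: measurable_funS mu_; first exact: measurable_completed_itv.
  by rewrite -xyz => t /=; rewrite !in_itv/=; lra.
- by move=> t; rewrite -xyz /= in_itv/= => ?; apply: u0; lra.
- by apply/disj_setPS => t []/=; rewrite !in_itv/=; lra.
rewrite EFinD leeD//; last by apply: ih => //; lra.
rewrite EFinM; have -> : (y - x)%:E = mu `[x, y[.
  by rewrite completed_lebesgue_measure_itv/= lte_fin xy.
rewrite -integral_cst//; apply: ge0_le_integral => //.
- by move=> t; rewrite lee_fin => _; apply: f0; lra.
- apply: measurable_funS mu_; first exact: measurable_completed_itv.
  by move=> t /=; rewrite !in_itv/=; lra.
- by move=> t; rewrite /= in_itv/= => ?; apply: fu; lra.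
Qed.

Lemma open_superset_le (F : set R) e : 0 < e ->
  exists U : set R, [/\ open U, F `<=` U & (mu U <= mu F + e%:E)%E].
Proof. exact: outer_measure_open_le. Qed.

Lemma riemann_sum_le_integral_nonneg a b f e : a <= b ->
  measurable_fun (`[a, b] : set LR) (f : LR -> R) ->
  (forall x, a <= x <= b -> 0 <= f x) -> 0 < e ->
  exists2 delta, is_gauge a b delta &
    forall P : tagged_partition a b, delta_fine delta P ->
      ((riemann_sum P f)%:E <= \int[mu]_(x in `[a, b]) (f x)%:E + e%:E)%E.
Proof.
move=> ab mf f0 e0.
pose D : set LR := `[a, b]%classic.
have mD : measurable D := measurable_completed_itv `[a, b].
have muD := completed_lebesgue_measure_segment ab.
have ba0 : 0 < b - a + 1 by lra.
(* With this choice [eta * (b - a)] is at most [e / 2]; the added 1 keeps the divisor positive when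
   [a = b]. *)
pose eta := e / 2 / (b - a + 1).
have n0 : 0 < eta by rewrite !divr_gt0.
pose F k : set LR := D `&` [set x | k.+1%:R * eta < f x].
have mF k : measurable (F k).
  rewrite (_ : F k = D `&` f @^-1` `]k.+1%:R * eta, +oo[).
    by apply: mf => //; exact: measurable_itv.
  by apply/seteqP; split => x /=; rewrite !in_itv/= andbT.
(* The excess measure allowed for [O k]: multiplied by [eta] it is [e / 2 / (2 ^ k.+1)%:R], which
   sums to [e / 2] over [k]. *)
have tau0 k : 0 < e / 2 / (2 ^ k.+1)%:R / eta.
  by rewrite !divr_gt0// ltr0n expn_gt0.
pose O k : set R := projT1 (cid (open_superset_le (F k) (tau0 k))).
have [oO FO muO] : [/\ forall k, open (O k), forall k, F k `<=` O k &
    forall k, (mu (O k) <= mu (F k) + (e / 2 / (2 ^ k.+1)%:R / eta)%:E)%E].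
  by split=> k; rewrite /O; case: cid => U [].
have mO k : measurable (O k : set LR).
  by apply: measurable_completed; exact: open_measurable.
pose U (t : LR) : \bar R := (\sum_(k <oo) eta%:E * (\1_(O k) t)%:E)%E.
have U0 t : (0 <= U t)%E by apply: indic_series_ge0; exact: ltW.
have mU : measurable_fun D U by exact: measurable_indic_series (ltW n0) mO.
(* Shrinking each [O k] to [F k] costs [e / 2] in total, and at each point the layers of the level
   sets add up to at most [f]. *)
have intU : (\int[mu]_(x in D) U x <=
    \int[mu]_(x in D) (f x)%:E + (e / 2)%:E)%E.
  rewrite (integral_indic_series mu mD (ltW n0) mO).
  apply: (@le_trans _ _ (\sum_(k <oo) (eta%:E * mu (F k `&` D) +
      (e / 2 / (2 ^ k.+1)%:R)%:E))%E).
    apply: lee_nneseries => k _.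
      by move=> _; rewrite mule_ge0 ?lee_fin ?(ltW n0).
    apply: (@le_trans _ _ (eta%:E * (mu (F k `&` D) +
        (e / 2 / (2 ^ k.+1)%:R / eta)%:E))%E).
      apply: lee_wpmul2l; first by rewrite lee_fin ltW.
      rewrite setIAC setIid; apply: le_trans (muO k).
      by apply: le_measure; rewrite ?inE//; exact: measurableI.
    rewrite ge0_muleDr ?lee_fin ?(ltW (tau0 _))// -EFinM.
    by rewrite [eta * _]mulrC divfK// gt_eqF.
  apply: (le_trans (epsilon_trick _ _ _)).
  - by move=> k; rewrite mule_ge0 ?lee_fin ?(ltW n0).
  - by rewrite ltW// divr_gt0.
  rewrite leeD2r// -(integral_indic_series mu mD (ltW n0) mF).
  apply: ge0_le_integral; [exact: mD|..].
  - by move=> x _; apply: indic_series_ge0; exact: ltW.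
  - exact: measurable_indic_series (ltW n0) mF.
  - exact/measurable_EFinP.
  - move=> x Dx; have xab : a <= x <= b by move: Dx; rewrite /D/= in_itv.
    apply: lime_le.
      by apply: is_cvg_nneseries => k _ _; apply: scaled_indic_ge0; exact: ltW.
    apply: nearW => m; under eq_bigr do rewrite -EFinM.
    rewrite sumEFin lee_fin big_mkord.
    apply: le_trans (layer_sum_le m (ltW n0) (f0 _ xab)).
    apply: ler_sum => k _; rewrite ler_wpM2l ?(ltW n0)// indicE ler_nat.
    have [|//] := boolP (x \in F k).
    by rewrite inE => -[_ /= ->].
have U_ge c : a <= c <= b -> \forall t \near c, ((f c)%:E <= eta%:E + U t)%E.
  move=> cab.
  have exK : exists K, f c <= K.+1%:R * eta.
    exists (Num.truncn (f c / eta)); rewrite -ler_pdivrMr// ltW//.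
    exact: truncnS_gt.
  (* By minimality [c] lies in [F k] for all [k < K], so near [c] the first [K] terms of [U] all
     equal [eta], and with the extra [eta] they reach [K.+1%:R * eta]. *)
  case: (ex_minnP exK) => K fK minK.
  have : \forall t \near c, forall k, (k < K)%N -> O k t.
    have Oc k : (k < K)%N -> O k c.
      move=> kK; apply: FO; split => /=; first by rewrite /D/= in_itv.
      by rewrite ltNge; apply/negP => /minK; rewrite leqNgt kK.
    elim: K {fK minK} Oc => [_|K ih Oc]; first by near=> t.
    have nK := ih (fun k kK => Oc k (ltnW kK)).
    have nO := open_nbhs_nbhs (conj (oO K) (Oc K (leqnn _))).
    near=> t => k; rewrite ltnS leq_eqVlt => /predU1P[->|].
      by near: t.
    by move: k; near: t.
  apply: filterS => t Ot.
  apply: (@le_trans _ _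
      (eta%:E + \sum_(0 <= k < K) eta%:E * (\1_(O k) t)%:E)%E).
    rewrite big_nat_cond (eq_bigr (fun=> eta%:E)); last first.
      move=> k /andP[/andP[_ kK] _].
      by rewrite indicE mem_set ?mule1//; exact: Ot.
    rewrite -big_nat_cond sumEFin -EFinD lee_fin sumr_const_nat subn0.
    by rewrite -mulrS -mulr_natl.
  rewrite leeD2l//; apply: nneseries_lim_ge => k _ _.
  by rewrite -EFinM lee_fin mulr_ge0// ltW.
clearbody U.
have /choice[delta deltaP] : forall c, exists d, 0 < d /\ (a <= c <= b ->
    forall t, c - d < t < c + d -> ((f c)%:E <= eta%:E + U t)%E).
  (* Outside [a, b] the radius 1 is a junk value that makes the choice total. *)
  move=> c; have [/U_ge|_] := boolP (a <= c <= b); last by exists 1.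
  move=> /nbhs_ballP[d /= d0 dU]; exists d; split=> // _ t td.
  by apply: dU; rewrite /ball/= ltr_distlC; lra.
exists delta => [c _|P fP]; first by have [] := deltaP c.
apply: (@le_trans _ _ (\int[mu]_(x in D) (eta%:E + U x))%E).
  apply: fine_sum_le_integral (partition_fine_sum f fP) => //.
  - exact: emeasurable_funD.
  - by move=> x _; rewrite adde_ge0// lee_fin ltW.
  - by move=> c t cab _; exact: (deltaP c).2.
rewrite ge0_integralD//; last by move=> x _; rewrite lee_fin ltW.
rewrite integral_cst// muD -EFinM addeC.
apply: (le_trans (leeD intU (lexx _))); rewrite -addeA leeD2l// -EFinD lee_fin.
rewrite [leRHS]splitr lerD2l /eta mulrAC ler_pdivrMr// ler_wpM2l//; first lra.
lra.
Unshelve. all: by end_near. Qed.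

(** Adding [n] to the truncation at [- n%:R] makes it nonnegative and adds the same [n%:R * (b - a)]
    to Riemann sums and to the integral. Half of [e] pays for the truncation, half for the
    nonnegative case. *)
Lemma riemann_sum_le_integral a b f e : a <= b ->
  lebesgue_integrable a b f -> 0 < e ->
  exists2 delta, is_gauge a b delta &
    forall P : tagged_partition a b, delta_fine delta P ->
      ((riemann_sum P f)%:E <= \int[mu]_(x in `[a, b]) (f x)%:E + e%:E)%E.
Proof.
move=> ab fi e0.
pose D : set LR := `[a, b]%classic.
have mD : measurable D := measurable_completed_itv `[a, b].
have muD := completed_lebesgue_measure_segment ab.
have e20 : 0 < e / 2 by rewrite divr_gt0.
have [n [Fi Fn]] := integral_truncation_le mD fi e20.
pose F (x : LR) : R := Num.max (f x) (- n%:R).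
have mF : measurable_fun D F.
  by apply/measurable_EFinP; exact: measurable_int Fi.
have [||delta gd deltaP] := @riemann_sum_le_integral_nonneg a b
  (fun x => F x + n%:R) (e / 2) ab _ _ e20.
- exact: measurable_funD.
- by move=> x _; rewrite -lerBlDr sub0r /F le_max lexx orbT.
exists delta => // P /deltaP; rewrite riemann_sumD riemann_sum_cst.
have ni : (mu : {measure set LR -> \bar R}).-integrable D (EFin \o cst n%:R).
  apply/integrableP; split; first by apply/measurable_EFinP.
  rewrite (eq_integral (cst `|n%:R|%:E))//.
  by rewrite integral_cst// muD -EFinM ltry.
under eq_integral do rewrite EFinD.
rewrite (integralD_EFin mD Fi ni).
rewrite [X in (_ + X + _)%E](_ : _ = (n%:R * (b - a))%:E); last first.
  by rewrite (eq_integral (cst n%:R%:E))// integral_cst// muD.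
rewrite EFinD addeAC leeD2rE// => SF.
apply: (@le_trans _ _ (riemann_sum P F)%:E).
  by rewrite lee_fin; apply: ler_riemann_sum => x; rewrite /F le_max lexx.
apply: (le_trans SF); rewrite [in leRHS](splitr e) EFinD addeA.
exact: leeD2r.
Qed.

Lemma lebesgue_integrable_gauge_integral a b f : a <= b ->
  lebesgue_integrable a b f ->
  gauge_integral a b f (fine (\int[mu]_(x in `[a, b]) (f x)%:E)).
Proof.
move=> ab fi e e0; have e20 : 0 < e / 2 by rewrite divr_gt0.
have mD := measurable_completed_itv `[a, b].
have finI := integrable_fin_num mD fi.
have Nfi : lebesgue_integrable a b (fun x => - f x) by exact: integrableN fi.
have [d gd dP] := riemann_sum_le_integral ab fi e20.
have [d' gd' dP'] := riemann_sum_le_integral ab Nfi e20.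
exists (fun x => Num.min (d x) (d' x)); first exact: is_gauge_min.
move=> P fP.
have /dP {}dP : delta_fine d P.
  by apply: delta_fineS fP => x; rewrite ge_min lexx.
have /dP' {}dP' : delta_fine d' P.
  by apply: delta_fineS fP => x; rewrite ge_min lexx orbT.
move: dP dP'; rewrite riemann_sumN.
under [in X in _ -> X -> _]eq_integral do rewrite EFinN.
rewrite integralN; last by apply: integrable_add_def fi.
rewrite -[X in (_ <= X + _)%E](fineK finI) -[X in (_ <= - X + _)%E](fineK finI).
rewrite -EFinN -!EFinD !lee_fin => h1 h2.
rewrite ltr_norml; lra.
Qed.

(** * Measurable majorants from step functions on uniform grids *)

Definition grid_pt a b n i : R := a + i%:R * ((b - a) / n.+1%:R).

Lemma grid_ptS a b n i :
  grid_pt a b n i.+1 = grid_pt a b n i + (b - a) / n.+1%:R.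
Proof. by rewrite /grid_pt -(natr1 i) mulrDl mul1r addrA. Qed.

Lemma grid_pt0 a b n : grid_pt a b n 0 = a.
Proof. by rewrite /grid_pt mul0r addr0. Qed.

Lemma grid_ptn a b n : grid_pt a b n n.+1 = b.
Proof. by rewrite /grid_pt mulrC divfK// addrC subrK. Qed.

Lemma grid_pt_ge a b n i : a <= b -> a <= grid_pt a b n i.
Proof. by move=> ab; rewrite lerDl mulr_ge0// divr_ge0// subr_ge0. Qed.

Lemma grid_pt_le a b n i : a <= b -> (i <= n.+1)%N -> grid_pt a b n i <= b.
Proof.
move=> ab lein; rewrite -[leRHS](grid_ptn a b n) lerD2l ler_wpM2r ?ler_nat//.
by rewrite divr_ge0// subr_ge0.
Qed.

(* The values on the [i]-th grid cell of [g] at the points that may tag the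
   whole cell, together with the junk value [0] making this set nonempty. *)
Definition cell_values a b delta g n i : set R :=
  [set w | w = 0 \/ exists c, [/\ grid_pt a b n i <= c <= grid_pt a b n i.+1,
     (b - a) / n.+1%:R < delta c & w = g c]].

(** A value [g c] comes with a tag whose radius exceeds the cell length, so the whole cell is fine
    for [c]. A cell with the junk value 0 is filled by Cousin's lemma, at a nonnegative sum. *)
Lemma cell_values_sum a b delta g n w : a < b -> is_gauge a b delta ->
  (forall x, a <= x <= b -> 0 <= g x) ->
  (forall i, (i < n.+1)%N -> cell_values a b delta g n i (w i)) ->
  exists2 P : tagged_partition a b, delta_fine delta P &
    (\sum_(i < n.+1) w i) * ((b - a) / n.+1%:R) <= riemann_sum P g.
Proof.
move=> ab gd g0 Ww; set l := (b - a) / _.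
have l0 : 0 < l by rewrite divr_gt0// subr_gt0.
suff H m : (m <= n.+1)%N -> exists2 v, (\sum_(i < m) w i) * l <= v &
    fine_sum delta g a (grid_pt a b n m) v.
  have [v wv] := H _ (leqnn _).
  rewrite grid_ptn => /fine_sum_partition[P fP Pv].
  by exists P => //; rewrite Pv.
elim: m => [_|m ih mn].
  by exists 0; [rewrite big_ord0 mul0r|rewrite grid_pt0; exact: fine_sum_nil].
have [v wv fv] := ih (ltnW mn).
suff [v' wv' fv'] : exists2 v', w m * l <= v' &
    fine_sum delta g (grid_pt a b n m) (grid_pt a b n m.+1) v'.
  exists (v + v'); last exact: fine_sum_cat fv fv'.
  by rewrite big_ord_recr/= mulrDl lerD.
have gm : a <= grid_pt a b n m by rewrite grid_pt_ge// ltW.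
have gm1 : grid_pt a b n m.+1 <= b by rewrite grid_pt_le// ltW.
have gS : grid_pt a b n m.+1 = grid_pt a b n m + l by exact: grid_ptS.
have [->|[c [cm dc ->]]] := Ww m mn.
  have [|x|x|v' v'0 fv'] := @fine_sum_exists _ delta g (grid_pt a b n m)
    (grid_pt a b n m.+1).
  - by rewrite gS lerDl ltW.
  - by move=> xm; apply: gd; rewrite in_itv/=; lra.
  - by move=> xm; apply: g0; lra.
  - by exists v' => //; rewrite mul0r.
exists (g c * l) => //.
have -> : l = grid_pt a b n m.+1 - grid_pt a b n m by rewrite gS; lra.
by move: dc; rewrite -/l => dc; apply: fine_sum1 => //; lra.
Qed.

(** Closed cells overlap at grid points, where the suprema add up; lower bounds survive and the
    integral is unaffected. *)
Definition cell_step a b delta g n x : \bar R :=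
  (\sum_(i < n.+1) (sup (cell_values a b delta g n i))%:E *
    (\1_(`[grid_pt a b n i, grid_pt a b n i.+1]) x)%:E)%E.

Lemma cell_step_measurable a b delta g n :
  measurable_fun (`[a, b] : set LR) (cell_step a b delta g n : LR -> \bar R).
Proof.
apply: emeasurable_sum => i; apply: measurable_funeM; apply/measurable_EFinP.
by apply: measurable_indic; exact: measurable_completed_itv.
Qed.

Section fixed_gauge.
Variables (a b K : R) (delta g : R -> R).
Hypotheses (ab : a < b) (gd : is_gauge a b delta).
Hypothesis (g0 : forall x, a <= x <= b -> 0 <= g x).
Hypothesis (gK : forall P : tagged_partition a b, delta_fine delta P ->
  riemann_sum P g <= K).

Let l0 n : 0 < (b - a) / n.+1%:R.
Proof. by rewrite divr_gt0// subr_gt0. Qed.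

Let cell_sum_le n (w : 'I_n.+1 -> R) :
  (forall i : 'I_n.+1, cell_values a b delta g n i (w i)) ->
  \sum_(i < n.+1) w i <= K / ((b - a) / n.+1%:R).
Proof.
move=> Ww; rewrite ler_pdivlMr//.
have [|P fP] := @cell_values_sum a b delta g n (w \o inord) ab gd g0.
  by move=> i si; have := Ww (inord i); rewrite inordK.
under eq_bigr do rewrite /= inord_val.
by move=> /le_trans; apply; exact: gK.
Qed.

Let has_sup_cell n i : (i < n.+1)%N -> has_sup (cell_values a b delta g n i).
Proof.
move=> ni.
exact: (@has_sup_of_bounded_sums _ _
  (fun i : 'I_n.+1 => cell_values a b delta g n i) _
  (fun=> or_introl erefl) (@cell_sum_le n) (Ordinal ni)).
Qed.

Let sup_cell_ge0 n i : (i < n.+1)%N -> 0 <= sup (cell_values a b delta g n i).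
Proof. by move=> /has_sup_cell[_ ?]; apply: ub_le_sup => //; left. Qed.

Lemma cell_step_ge0 n x : (0 <= cell_step a b delta g n x)%E.
Proof.
by apply: sume_ge0 => i _; rewrite -EFinM lee_fin mulr_ge0// sup_cell_ge0.
Qed.

(** The point [x] may itself tag a cell containing it, so [g x] is among the values whose supremum
    is taken there. *)
Lemma cell_step_ge n x : a <= x <= b -> (b - a) / n.+1%:R < delta x ->
  ((g x)%:E <= cell_step a b delta g n x)%E.
Proof.
move=> xab dx.
have [i ni xi] : exists2 i, (i < n.+1)%N &
    grid_pt a b n i <= x <= grid_pt a b n i.+1.
  suff H m : x <= grid_pt a b n m.+1 -> exists2 i, (i < m.+1)%N &
      grid_pt a b n i <= x <= grid_pt a b n i.+1.
    by apply: H; rewrite grid_ptn; case/andP: xab.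
  elim: m => [|m ih] xm.
    by exists 0%N => //; rewrite xm grid_pt0 andbT; case/andP: xab.
  have [/ih[i im xi]|/ltW mx] := leP x (grid_pt a b n m.+1).
    by exists i => //; exact: ltnW.
  by exists m.+1 => //; rewrite mx.
rewrite /cell_step (bigD1 (Ordinal ni))//= indicE mem_set/= ?in_itv//= mule1.
rewrite -[leLHS]adde0 leeD//; last first.
  by apply: sume_ge0 => j _; rewrite -EFinM lee_fin mulr_ge0// sup_cell_ge0.
rewrite lee_fin; apply: ub_le_sup; first by case: (has_sup_cell ni).
by right; exists x; split.
Qed.

(** One value per cell, times the cell length, sums to at most the Riemann sum of a fine partition,
    hence to at most [K]; [sum_sup_le] carries this over to the suprema. *)
Lemma integral_cell_step n :
  (\int[mu]_(x in `[a, b]) cell_step a b delta g n x <= K%:E)%E.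
Proof.
have mD := measurable_completed_itv `[a, b].
have mI i : measurable_fun (`[a, b] : set LR)
    (fun x : LR => (\1_(`[grid_pt a b n i, grid_pt a b n i.+1]) x)%:E : \bar R).
  apply/measurable_EFinP; apply: measurable_indic.
  exact: measurable_completed_itv.
rewrite ge0_integral_sum//; last 2 first.
- by move=> i; apply: measurable_funeM; exact: mI.
- by move=> i x _; rewrite -EFinM lee_fin mulr_ge0// sup_cell_ge0.
apply: (@le_trans _ _ (\sum_(i < n.+1) (sup (cell_values a b delta g n i) *
    ((b - a) / n.+1%:R))%:E)%E).
  apply: lee_sum => i _.
  rewrite (ge0_integralZl_EFin mu mD _ (mI i)) ?sup_cell_ge0//.
  rewrite EFinM; apply: lee_wpmul2l; first by rewrite lee_fin sup_cell_ge0.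
  rewrite integral_indic//; last exact: measurable_completed_itv.
  apply: (@le_trans _ _ (mu `[grid_pt a b n i, grid_pt a b n i.+1])).
    have mi := measurable_completed_itv.
    by apply: le_measure; rewrite ?inE//; exact: measurableI.
  rewrite completed_lebesgue_measure_itv/= lte_fin grid_ptS ltrDl l0.
  by rewrite -EFinB lee_fin; rewrite addrAC subrr add0r.
rewrite sumEFin lee_fin -mulr_suml -ler_pdivlMr//.
exact: (@sum_sup_le _ _ (fun i : 'I_n.+1 => cell_values a b delta g n i)
  _ (fun=> or_introl erefl) (@cell_sum_le n)).
Qed.

Lemma measurable_majorant_gauge : exists u : LR -> \bar R,
  [/\ measurable_fun (`[a, b] : set LR) u,
      forall x, a <= x <= b -> ((g x)%:E <= u x)%E &
      (\int[mu]_(x in `[a, b]) u x <= K%:E)%E].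
Proof.
pose s n : LR -> \bar R := cell_step a b delta g n.
have lim_einf_ge (v : (\bar R)^nat) k :
    (\forall n \near \oo, (k <= v n)%E) -> (k <= limn_einf v)%E.
  move=> [N _ Nk]; rewrite limn_einf_lim; apply: lime_ge.
    exact: is_cvg_einfs.
  exists N => // n Nn; apply: le_ereal_inf_tmp => _ [m /= nm <-].
  by apply: Nk => /=; exact: leq_trans Nn nm.
exists (fun x => limn_einf (s ^~ x)); split.
(* [limn_einf] unfolds to the opposite of the [limn_esup] of the opposites. *)
- apply: measurableT_comp => //; apply: measurable_fun_limn_esup => n.
  by apply: measurableT_comp => //; exact: cell_step_measurable.
- move=> x xab; apply: lim_einf_ge.
  have dx : 0 < delta x / (b - a).
    by rewrite divr_gt0 ?subr_gt0// gd// in_itv.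
  near=> n; apply: cell_step_ge => //.
  rewrite mulrC -ltr_pdivlMr ?subr_gt0//.
  by near: n; exact: (near_infty_natSinv_lt (PosNum dx)).
- have mD := measurable_completed_itv `[a, b].
  have := fatou mu mD (@cell_step_measurable a b delta g)
    (fun n x _ => cell_step_ge0 n x).
  move/le_trans; apply.
  rewrite limn_einf_lim; apply: lime_le; first exact: is_cvg_einfs.
  apply: nearW => n; apply: ge_ereal_inf.
  exists (\int[mu]_(x in `[a, b]) s n x)%E; last exact: integral_cell_step.
  by exists n => //=.
Unshelve. all: by end_near. Qed.

End fixed_gauge.

(** The infimum of majorants for the tolerances [n.+1%:R^-1] is still at least [g], and its integral
    is below every [I + n.+1%:R^-1]. *)
Lemma measurable_majorant a b g I : a < b ->
  (forall x, a <= x <= b -> 0 <= g x) -> gauge_integral a b g I ->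
  exists u : LR -> \bar R,
  [/\ measurable_fun (`[a, b] : set LR) u,
      forall x, a <= x <= b -> ((g x)%:E <= u x)%E &
      (\int[mu]_(x in `[a, b]) u x <= I%:E)%E].
Proof.
move=> ab g0 gI.
have /choice[u uP] n : exists u : LR -> \bar R,
  [/\ measurable_fun (`[a, b] : set LR) u,
      forall x, a <= x <= b -> ((g x)%:E <= u x)%E &
      (\int[mu]_(x in `[a, b]) u x <= (I + n.+1%:R^-1)%:E)%E].
  have [|d gd dP] := gI n.+1%:R^-1; first by rewrite invr_gt0.
  apply: measurable_majorant_gauge ab gd g0 _ => P /dP.
  by rewrite ltr_norml => /andP[_ /ltW]; rewrite lerBlDl.
(* The tail infimum from index 0 is the infimum over all [n]. *)
pose w x := einfs (u ^~ x) 0%N.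
have mw : measurable_fun (`[a, b] : set LR) w.
  by apply: measurable_fun_einfs => n; have [] := uP n.
have gw x : a <= x <= b -> ((g x)%:E <= w x)%E.
  move=> xab; apply: le_ereal_inf_tmp => _ [n _ <-].
  by have [_ + _] := uP n; apply.
exists w; split => //.
apply/lee_addgt0Pr => e e0.
have [n ne] : exists n, n.+1%:R^-1 < e.
  have [N _ +] := near_infty_natSinv_lt (PosNum e0).
  by move=> /(_ N (leqnn N)); exists N.
have [mun _ un] := uP n.
apply: le_trans (_ : \int[mu]_(x in `[a, b]) u n x <= _)%E.
  apply: ge0_le_integral => //.
  - exact: measurable_completed_itv.
  - move=> x; rewrite /= in_itv/= => xab.
    by apply: le_trans (gw _ xab); rewrite lee_fin g0.
  - by move=> x _; apply: ge_ereal_inf; exists (u n x) => //; exists n.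
by apply: (le_trans un); rewrite -EFinD lee_fin lerD2l ltW.
Qed.

(** * Nonnegative gauge integrable functions are Lebesgue integrable *)

Lemma gauge_integral_nonneg_integrable a b g I : a < b ->
  (forall x, a <= x <= b -> 0 <= g x) -> gauge_integral a b g I ->
  lebesgue_integrable a b g.
Proof.
move=> ab g0 gI.
pose D : set LR := `[a, b]%classic.
have mD : measurable D := measurable_completed_itv `[a, b].
have DE x : D x = (a <= x <= b) :> Prop by rewrite /D/= in_itv.
have [u [mu_ gu uI]] := measurable_majorant ab g0 gI.
have ui : (mu : {measure set LR -> \bar R}).-integrable D u.
  apply/integrableP; split => //; apply: le_lt_trans (ltry I).
  apply: le_trans uI; apply: ge0_le_integral => //.
  - exact: measurableT_comp.
  - move=> x; rewrite DE => xab; rewrite gee0_abs//.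
    by apply: le_trans (gu _ xab); rewrite lee_fin g0.
(* On the null set [u = +oo], [g] itself serves as a finite majorant; [v] is
   measurable because the measure is complete. *)
pose v x : R := if u x \is a fin_num then fine (u x) else g x.
have uv : ae_eq mu D u (EFin \o v).
  apply: filterS (integrable_ae mD ui) => x /= ufin Dx.
  by rewrite /v ufin// fineK// ufin.
have vi : lebesgue_integrable a b v.
  exact: complete_ae_eq_integrable
    completed_lebesgue_measure_is_complete mD uv ui.
have mv : measurable_fun D (EFin \o v) by exact: measurable_int vi.
have gv x : a <= x <= b -> g x <= v x.
  move=> xab; rewrite /v; case: ifPn => // ufin.
  by rewrite -lee_fin fineK// gu.
have intv : (\int[mu]_(x in D) (v x)%:E <= I%:E)%E.
  by rewrite -(ae_eq_integral _ _ mD mu_ mv uv).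
(* The gauge integral of [v - g] is the integral of [v] minus [I], which is at most 0 by [intv]. *)
have hI := gauge_integralD (lebesgue_integrable_gauge_integral (ltW ab) vi)
  (gauge_integralN gI).
have h0 x : a <= x <= b -> 0 <= v x - g x by move=> /gv; rewrite subr_ge0.
have [w [mw hw wI]] := measurable_majorant ab h0 hI.
have w0 : (\int[mu]_(x in D) `|w x| = 0)%E.
  apply/eqP; rewrite eq_le integral_ge0// andbT.
  rewrite (eq_integral w); last first.
    move=> x; rewrite inE DE => xab; rewrite gee0_abs//.
    by apply: le_trans (hw _ xab); rewrite lee_fin h0.
  apply: (le_trans wI); rewrite lee_fin subr_le0 -lee_fin fineK.
    exact: intv.
  exact: (integrable_fin_num mD vi).
(* Where [w] vanishes, [0 <= v - g <= w] forces [v = g]. *)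
have vg : ae_eq mu D (EFin \o v) (EFin \o g).
  have /(ae_eq_integral_abs mu mD mw) := w0.
  apply: filterS => x /= wx Dx; have xab : a <= x <= b by rewrite -DE.
  have := hw _ xab; rewrite wx// lee_fin => ?; have := h0 _ xab => ?.
  by congr EFin; lra.
exact: complete_ae_eq_integrable
  completed_lebesgue_measure_is_complete mD vg vi.
Qed.

End lebesgue.

(** * Equivalence with the convergence of both nets *)

Theorem theorem3 (R : realType) (a b : R) (ab : a <= b) (f : R -> R) :
  lebesgue_integrable a b f <->
  net_convergent (fun g : fine_pairs ab => riemann_sum (fp_part g) f) /\
  net_convergent
    (fun g : fine_pairs ab => riemann_sum (fp_part g) (fun x => `|f x|)).
Proof.
split=> [fi|[/net_convergentP[I fI] /net_convergentP[J fJ]]].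
  split; apply/net_convergentP; eexists.
    exact: lebesgue_integrable_gauge_integral fi.
  exact/(lebesgue_integrable_gauge_integral ab)/(integrable_norm fi).
(* When [a = b] the interval is a null set, on which [f] agrees almost everywhere with 0; the grids
   need [a < b]. *)
have [ab'|ba] := ltP a b; last first.
  have {ba} <- : a = b by apply/le_anti/andP.
  have mD := measurable_completed_itv `[a, a].
  apply: (complete_ae_eq_integrable (f := cst 0%E)
    completed_lebesgue_measure_is_complete mD); last exact: integrable0.
  exists `[a, a]%classic; split => //; last by move=> x /= /not_implyP[].
  by rewrite [LHS]completed_lebesgue_measure_itv/= ltxx.
have mD := measurable_completed_itv `[a, b].
have pi : lebesgue_integrable a b (fun x => `|f x| + f x).
  apply: gauge_integral_nonneg_integrable ab' _ (gauge_integralD fJ fI).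
  by move=> x _; have := ler_norm (- f x); rewrite normrN; lra.
have ni : lebesgue_integrable a b (fun x => `|f x| - f x).
  apply: gauge_integral_nonneg_integrable ab' _
    (gauge_integralD fJ (gauge_integralN fI)).
  by move=> x _; have := ler_norm (f x); lra.
have := integrableZl mD (2^-1) (integrableB mD pi ni).
rewrite /lebesgue_integrable; congr (_.-integrable _ _); apply/funext => x /=.
by rewrite -EFinB -EFinM; congr EFin; lra.
Qed.
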